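(* Let $L>0$. For all $T>0$ satisfying $\pi T>L^2$, there exists a constant $C>0$ such that for any smooth solution $z$ of $$\begin{cases}\partial_t z-\partial_{xx}z=0 & \text{in }(0,\infty)\times(-L,L),\\ z(t,-L)=z(t,L)=0 & \text{in }(0,\infty),\\ z(0,x)=z_0(x)&\text{in }(-L,L),\end{cases}$$ we have the observability inequality $$\int_{-L}^{L}|z(T,x)|^2\exp\left(\frac{x^2-L^2}{2T}\right)dx+\int_0^\infty\int_{-L}^{L}|z(t,x)|^2\exp\left(\frac{x^2-L^2}{2t}\right)dx\,dt\le C\int_0^T t\left(|\partial_x z(t,-L)|^2+|\partial_x z(t,L)|^2\right)dt.$$
   Context: Solutions are complex valued. The constant $C$ may depend on $L$ and $T$ but not on $z$. *)

(* Defs.v *)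
From HB Require Import structures.
From mathcomp Require Import all_boot all_order all_algebra.
From mathcomp Require Import all_classical all_reals all_analysis.
From mathcomp Require Import complex.

Set Implicit Arguments.
Unset Strict Implicit.
Unset Printing Implicit Defensive.

Import Order.TTheory GRing.Theory Num.Theory.
Import numFieldNormedType.Exports.

Local Open Scope classical_set_scope.
Local Open Scope ring_scope.

Section calculus.
Variable R : realType.
Implicit Types (A : set R) (f : R -> R) (u : R -> R -> R).

(* Derivative relative to A: two-sided at interior points of A, one-sided at
   the endpoints of a closed interval.  Values of f outside A are irrelevant. *)
Definition diff_quot f (x y : R) : R := (f y - f x) / (y - x).

Definition derivable_in A f (x : R) : Prop :=
  cvg (diff_quot f x y @[y --> within A x^']).

Definition derive_in A f (x : R) : R :=
  lim (diff_quot f x y @[y --> within A x^']).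

(* For u = u(t, x), regarded on the product I `*` J. *)
Definition partial_t (I : set R) u : R -> R -> R :=
  fun t x => derive_in I (fun s => u s x) t.

Definition partial_x (J : set R) u : R -> R -> R :=
  fun t x => derive_in J (u t) x.

(* C^n on I `*` J, up to those boundary points that belong to the set. *)
Fixpoint class_C (n : nat) (I J : set R) u : Prop :=
  {within I `*` J, continuous (fun p : R * R => u p.1 p.2)} /\
  if n is m.+1 then
    [/\ forall t x, I t -> J x -> derivable_in I (fun s => u s x) t,
        forall t x, I t -> J x -> derivable_in J (u t) x,
        class_C m I J (partial_t I u) &
        class_C m I J (partial_x J u)]
  else True.

End calculus.

Section complex_valued.
Variable R : realType.
Implicit Types z : R -> R -> R[i].

(* R[i] is regarded as the real vector space R^2: continuity and derivatives
   with respect to the real variables t, x are taken componentwise. *)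
Definition re_part z : R -> R -> R := fun t x => complex.Re (z t x).
Definition im_part z : R -> R -> R := fun t x => complex.Im (z t x).

Definition Cpartial_t (I : set R) z : R -> R -> R[i] :=
  fun t x => Complex (partial_t I (re_part z) t x) (partial_t I (im_part z) t x).

Definition Cpartial_x (J : set R) z : R -> R -> R[i] :=
  fun t x => Complex (partial_x J (re_part z) t x) (partial_x J (im_part z) t x).

Definition Ccontinuous_on (I J : set R) z : Prop :=
  {within I `*` J, continuous (fun p : R * R => re_part z p.1 p.2)} /\
  {within I `*` J, continuous (fun p : R * R => im_part z p.1 p.2)}.

Definition Csmooth_on (I J : set R) z : Prop :=
  forall n : nat, class_C n I J (re_part z) /\ class_C n I J (im_part z).

Definition dt z : R -> R -> R[i] := Cpartial_t `]0, +oo[ z.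
Definition dx (L : R) z : R -> R -> R[i] := Cpartial_x `[- L, L] z.

(* Smooth for t > 0 up to the lateral boundary, and continuous up to t = 0.
   Smoothness at t = 0 is not required: it would force compatibility conditions
   of every order on z0 at the endpoints. *)
Record smooth_heat_solution (L : R) (z0 : R -> R[i]) z : Prop := {
  heat_smooth : Csmooth_on `]0, +oo[ `[- L, L] z;
  heat_continuous : Ccontinuous_on `[0, +oo[ `[- L, L] z;
  heat_equation : forall t x, 0 < t -> - L < x < L ->
    dt z t x - dx L (dx L z) t x = 0;
  heat_boundary : forall t, 0 < t -> z t (- L) = 0 /\ z t L = 0;
  heat_initial : forall x, - L < x < L -> z 0 x = z0 x
}.

Definition normsq (w : R[i]) : R := ComplexField.Normc.normc w ^+ 2.

End complex_valued.

(* Main.v *)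
(* Conjugate the heat equation by the Gaussian weight: for
   [w = z exp((x^2 - L^2) / (4 t))] one gets
   [w_t = (w_xx + k w) - (x w_x + w / 2) / t] with [k = L^2 / (4 t^2)].
   Put [E = \int w^2], [D = \int w_x^2 - k E], [N = \int (w_xx + k w)^2] and
   [B = z_x(t, -L)^2 + z_x(t, L)^2].  Then [E' = -2 D] and
   [(t^2 D)' = -2 t^2 N + L t B], so [t^2 D] is controlled by the observation
   once it is known to be small along some sequence of times tending to 0.
   By the Poincare inequality with constant [(pi / (2 L))^2], [D] controls [E]
   for [t >= T] as soon as [pi T > L^2]; this bounds [E T] and makes [E]
   integrable at infinity.  Near [t = 0], [2 t D <= E / 2 + 2 t^2 N]
   gives [(t E - t^2 D)' >= E / 2 - L t B], whence the bound on [\int_0^T E].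
   Real and imaginary parts are treated separately and added. *)
Require Import Defs.
From mathcomp Require Import all_boot all_order all_algebra.
From mathcomp Require Import all_classical all_reals all_analysis.
From mathcomp Require Import complex.
From mathcomp Require Import measurable_realfun ring lra.
Import Order.TTheory GRing.Theory Num.Theory.
Import numFieldNormedType.Exports.
Local Open Scope classical_set_scope.
Local Open Scope ring_scope.

(** * Differentiation rules for real functions of one variable *)

Section derivative_rules.
Context {R : realType}.
Notation mu := (@lebesgue_measure R).
Implicit Types (f g : R -> R) (a b x : R).

Lemma is_derive1_cst (c x : R) : is_derive x 1 (fun=> c) 0.
Proof. exact: is_derive_cst. Qed.

Lemma is_derive1_id x : is_derive x 1 (fun y : R => y) 1.
Proof. exact: is_derive_id. Qed.

Lemma is_derive1D f g x df dg : is_derive x 1 f df -> is_derive x 1 g dg ->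
  is_derive x 1 (fun y => f y + g y) (df + dg).
Proof. by move=> hf hg; exact: is_deriveD. Qed.

Lemma is_derive1B f g x df dg : is_derive x 1 f df -> is_derive x 1 g dg ->
  is_derive x 1 (fun y => f y - g y) (df - dg).
Proof. by move=> hf hg; exact: is_deriveB. Qed.

Lemma is_derive1M f g x df dg : is_derive x 1 f df -> is_derive x 1 g dg ->
  is_derive x 1 (fun y => f y * g y) (f x * dg + g x * df).
Proof. by move=> hf hg; exact: is_deriveM. Qed.

Lemma is_derive1_sqr f x df : is_derive x 1 f df ->
  is_derive x 1 (fun y => f y ^+ 2) (2 * f x * df).
Proof.
move=> hf; have h : is_derive x 1 (fun y => f y ^+ 2) (f x * df + f x * df).
  exact: is_derive1M.
by apply: is_derive_eq; ring.
Qed.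

Lemma is_derive1V f x df : is_derive x 1 f df -> f x != 0 ->
  is_derive x 1 (fun y => (f y)^-1) (- df / f x ^+ 2).
Proof.
move=> hf f0; apply: (is_derive_eq (is_deriveV f0 hf)).
by rewrite /GRing.scale/= mulNr mulrC mulNr.
Qed.

Lemma is_derive1_expR f x df : is_derive x 1 f df ->
  is_derive x 1 (fun y => expR (f y)) (expR (f x) * df).
Proof.
by move=> hf; exact: is_derive1_comp.
Qed.

End derivative_rules.

(** * Continuity relative to a set *)

Definition cont_on {R : realType} {T : topologicalType} (A : set T)
  (f : T -> R) : Prop := {within A, continuous f}.

Section cont_on_theory.
Context {R : realType} {T : topologicalType}.
Implicit Types (A B : set T) (f g : T -> R).

Lemma cont_onP A f :
  cont_on A f <-> forall x, A x -> f y @[y --> within A (nbhs x)] --> f x.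
Proof. exact: subspace_continuousP. Qed.

Lemma cont_onW A B f : A `<=` B -> cont_on B f -> cont_on A f.
Proof. exact: continuous_subspaceW. Qed.

Lemma cont_on_cst A (c : R) : cont_on A (fun=> c).
Proof. by apply: continuous_subspaceT => ?; exact: cvg_cst. Qed.

Lemma cont_onD A f g : cont_on A f -> cont_on A g ->
  cont_on A (fun x => f x + g x).
Proof. by move=> cf cg x; apply: continuousD; [exact: cf|exact: cg]. Qed.

Lemma cont_onN A f : cont_on A f -> cont_on A (fun x => - f x).
Proof. by move=> cf x; apply: continuousN; exact: cf. Qed.

Lemma cont_onM A f g : cont_on A f -> cont_on A g ->
  cont_on A (fun x => f x * g x).
Proof. by move=> cf cg x; apply: continuousM; [exact: cf|exact: cg]. Qed.

Lemma cont_onX A f n : cont_on A f -> cont_on A (fun x => f x ^+ n).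
Proof.
move=> cf; elim: n => [|n ih]; first exact: cont_on_cst.
by under eq_fun do rewrite exprS; exact: cont_onM.
Qed.

Lemma cont_on_expR A f : cont_on A f -> cont_on A (fun x => expR (f x)).
Proof.
by move=> cf x; apply: continuous_comp; [exact: cf|exact: continuous_expR].
Qed.

Lemma cont_on_norm A f : cont_on A f -> cont_on A (fun x => `|f x|).
Proof.
by move=> cf x; apply: continuous_comp; [exact: cf|exact: norm_continuous].
Qed.

Lemma cont_onV A f : (forall x, A x -> f x != 0) -> cont_on A f ->
  cont_on A (fun x => (f x)^-1).
Proof.
by move=> f0 /cont_onP cf; apply/cont_onP => x Ax; apply: cvgV; [exact: f0|exact: cf].
Qed.

Lemma eq_cont_on A f g : {in A, f =1 g} -> cont_on A f -> cont_on A g.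
Proof. by move=> fg; apply: subspace_eq_continuous. Qed.

End cont_on_theory.

(** The search follows the syntax of the function and closes its atoms by assumption. The continuity
    of each atom, including the identity and inverses, must therefore be in the context beforehand,
    which explains the many auxiliary facts introduced before its calls. *)
Ltac prove_cont_on := repeat first
  [ assumption
  | match goal with
    | |- cont_on ?A (fun x => ?c) => exact (cont_on_cst A c)
    | |- cont_on ?A (fun x => - (@?f x)) => apply (@cont_onN _ _ A f)
    | |- cont_on ?A (fun x => (@?f x) + (@?g x)) => apply (@cont_onD _ _ A f g)
    | |- cont_on ?A (fun x => (@?f x) * (@?g x)) => apply (@cont_onM _ _ A f g)
    | |- cont_on ?A (fun x => (@?f x) ^+ ?n) => apply (@cont_onX _ _ A f n)
    | |- cont_on ?A (fun x => expR (@?f x)) => apply (@cont_on_expR _ _ A f)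
    end ].

(** * Integrals over compact intervals and the Poincare-Wirtinger inequality *)

Section interval_integral.
Context {R : realType}.
Notation mu := (@lebesgue_measure R).
Implicit Types (f g : R -> R) (a b x : R).

Lemma derive_cont_on f df a b :
  (forall x, a <= x <= b -> is_derive x 1 f (df x)) -> cont_on `[a, b] f.
Proof.
move=> dfE; apply: derivable_within_continuous => x; rewrite in_itv/= => xL.
by have := dfE _ xL => ?; exact: ex_derive.
Qed.

Lemma integrable_itvcc f a b : cont_on `[a, b] f ->
  mu.-integrable `[a, b] (EFin \o f).
Proof.
by move=> cf; apply: continuous_compact_integrable => //; exact: segment_compact.
Qed.

(** Differentiability is asked only in the open interval, so one-sided derivatives at the lateral
    boundary never have to be handled. *)
Lemma Rintegral_derive F f a b : a < b ->
  cont_on `[a, b] f -> cont_on `[a, b] F ->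
  (forall x, a < x < b -> is_derive x 1 F (f x)) ->
  \int[mu]_(x in `[a, b]) f x = F b - F a.
Proof.
move=> ab cf /(continuous_within_itvP _ ab)[cF Fa Fb] dF.
rewrite /Rintegral (@continuous_FTC2 _ _ F)//.
- by split => // x; rewrite in_itv/= => /dF h; exact: ex_derive.
- by move=> x; rewrite in_itv/= => /dF h; rewrite derive1E derive_val.
Qed.

(* [f'^2 - a^2 f^2 = (f' + a tan(ax) f)^2 - (a tan(ax) f^2)'] *)
Lemma wirtinger f df a L : 0 < L -> 0 < a -> a * L < pi / 2 ->
  cont_on `[- L, L] f -> cont_on `[- L, L] df ->
  (forall x, - L < x < L -> is_derive x 1 f (df x)) ->
  f (- L) = 0 -> f L = 0 ->
  a ^+ 2 * \int[mu]_(x in `[- L, L]) (f x ^+ 2) <=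
  \int[mu]_(x in `[- L, L]) (df x ^+ 2).
Proof.
move=> L0 a0 aL cf cdf dfE fNL fL.
have LL : - L < L by lra.
(* Since [a * L < pi / 2], the argument [a * x] stays away from the poles of the tangent on the
   whole closed interval. *)
have cosp x : - L <= x <= L -> 0 < cos (a * x).
  by move=> xL; apply: cos_gt0_pihalf; nra.
have dax x : is_derive x 1 (fun y => a * y) a.
  have := is_derive1M _ _ _ _ _ (is_derive1_cst a x) (is_derive1_id x).
  by rewrite mulr1 mulr0 addr0.
have dtan x : - L <= x <= L ->
    is_derive x 1 (fun y => tan (a * y)) (a * (1 + tan (a * x) ^+ 2)).
  move=> xL; have c0 : cos (a * x) != 0 by rewrite gt_eqF// cosp.
  have := is_derive1_comp (is_derive_tan c0) (dax x).
  by rewrite cos2_tan2// mulrC.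
have ctan : cont_on `[- L, L] (fun x => tan (a * x)).
  by apply: (@derive_cont_on _ (fun x => a * (1 + tan (a * x) ^+ 2))) => x; exact: dtan.
pose G x := f x ^+ 2 * tan (a * x).
pose g x := f x ^+ 2 * (a * (1 + tan (a * x) ^+ 2)) + tan (a * x) * (2 * f x * df x).
have cg : cont_on `[- L, L] g by rewrite /g; prove_cont_on.
have cG : cont_on `[- L, L] G by rewrite /G; prove_cont_on.
have intg0 : \int[mu]_(x in `[- L, L]) g x = 0.
  have dG x : - L < x < L -> is_derive x 1 G (g x).
    move=> xL; apply: is_derive1M; first exact/is_derive1_sqr/dfE.
    by apply: dtan; lra.
  rewrite (Rintegral_derive _ _ _ _ LL cg cG dG).
  by rewrite /G fNL fL expr2 !mul0r subrr.
have mI : measurable (`[- L, L] : set R) by exact: measurable_itv.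
rewrite -RintegralZl//; last by apply: integrable_itvcc; prove_cont_on.
(* Adding a multiple of the null integral of [g] makes the inequality pointwise: the difference of
   the integrands is then a perfect square. *)
have -> : \int[mu]_(x in `[- L, L]) (df x ^+ 2) =
    \int[mu]_(x in `[- L, L]) (df x ^+ 2 + a * g x).
  rewrite RintegralD//; [|by apply: integrable_itvcc; prove_cont_on..].
  by rewrite RintegralZl ?intg0 ?mulr0 ?addr0//; exact: integrable_itvcc.
apply: le_Rintegral => //; [by apply: integrable_itvcc; prove_cont_on..|].
move=> x _; rewrite -subr_ge0.
rewrite [leRHS](_ : _ = (df x + a * tan (a * x) * f x) ^+ 2) ?sqr_ge0//.
by rewrite /g; ring.
Qed.

End interval_integral.

(** * Two forms of the difference quotient *)

Section difference_quotient.
Context {R : realType}.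
Implicit Types (f : R -> R) (x l : R).

Lemma dnbhs_shift (P : R -> Prop) x :
  (\forall y \near x^', P y) <-> (\forall h \near 0^', P (h + x)).
Proof.
rewrite !near_withinE; split.
  move=> /nbhs_ballP[e/= e0 eP]; apply/nbhs_ballP; exists e => //= h.
  rewrite /ball/= sub0r normrN => he h0; apply: eP.
    by rewrite /ball/= opprD addrC addrNK normrN.
  by rewrite -subr_eq0 addrK.
move=> /nbhs_ballP[e/= e0 eP]; apply/nbhs_ballP; exists e => //= y.
rewrite /ball/= => ye yx; rewrite -(subrK x y); apply: eP.
  by rewrite /ball/= sub0r opprB.
by rewrite subr_eq0.
Qed.

(** Bridge between [is_derive], whose increments tend to 0, and the quotients with [y] tending to
    [x] by which the derivatives of a solution are defined. *)
Lemma is_derive1_diff_quotP f x l :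
  is_derive x 1 f l <-> (f y - f x) / (y - x) @[y --> x^'] --> l.
Proof.
have E : (h^-1 *: (f (h *: (1 : R) + x) - f x) @[h --> 0^'] --> l) <->
    ((f y - f x) / (y - x) @[y --> x^'] --> l).
  have e h : h^-1 *: (f (h *: (1 : R) + x) - f x) =
      (f (h + x) - f x) / (h + x - x).
    by rewrite addrK /GRing.scale/= mulr1 mulrC.
  under eq_fun do rewrite e.
  split=> /cvgrPdist_lt h; apply/cvgrPdist_lt => d d0.
    by apply/dnbhs_shift; exact: h.
  have /dnbhs_shift := h _ d0; exact.
split=> [[d lE]|h]; first by apply/E; rewrite -lE; exact: d.
have {}h : (h^-1 *: (f (h *: (1 : R) + x) - f x) @[h --> 0^'] --> l) by exact: (E.2 h).
by split; [apply/cvg_ex; exists l|exact/cvg_lim].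
Qed.

End difference_quotient.

(** * Continuity and differentiation of integrals depending on a parameter *)

Section parameter_integral.
Context {R : realType}.
Notation mu := (@lebesgue_measure R).

Lemma cont_on_comp {T U : topologicalType} (A : set T) (B : set U)
    (g : T -> U) (f : U -> R) :
  (forall x, A x -> B (g x)) -> continuous g -> cont_on B f ->
  cont_on A (f \o g).
Proof.
move=> AB cg /cont_onP cf; apply/cont_onP => x Ax.
have /cf h := AB _ Ax.
apply: cvg_comp h => P hP; change (\forall y \near x, A y -> P (g y)).
have : \forall y \near x, B (g y) -> P (g y) by exact: (cg x _ hP).
by apply: filterS => y h /AB; exact: h.
Qed.

Lemma cont_on_slice (I J : set R) (f : R -> R -> R) t :
  cont_on (I `*` J) (fun p => f p.1 p.2) -> I t -> cont_on J (f t).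
Proof.
move=> cf It.
apply: (@cont_on_comp _ _ J _ (fun x => (t, x)) (fun p => f p.1 p.2) _ _ cf) => //.
by move=> x; apply: (@cvg_pair _ _ _ _ (nbhs t) (nbhs x)); [exact: cvg_cst|exact: cvg_id].
Qed.

Lemma cont_on_trace (I J : set R) (f : R -> R -> R) x :
  cont_on (I `*` J) (fun p => f p.1 p.2) -> J x -> cont_on I (f ^~ x).
Proof.
move=> cf Jx.
apply: (@cont_on_comp _ _ I _ (fun t => (t, x)) (fun p => f p.1 p.2) _ _ cf) => //.
by move=> t; apply: (@cvg_pair _ _ _ _ (nbhs t) (nbhs x)); [exact: cvg_id|exact: cvg_cst].
Qed.

Lemma cont_on_fst (I J : set R) (h : R -> R) :
  cont_on I h -> cont_on (I `*` J) (fun p => h p.1).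
Proof.
by move=> ch; apply: (@cont_on_comp _ _ _ I fst) => // [x []//|x]; exact: cvg_fst.
Qed.

Lemma cont_on_snd (I J : set R) (h : R -> R) :
  cont_on J h -> cont_on (I `*` J) (fun p => h p.2).
Proof.
by move=> ch; apply: (@cont_on_comp _ _ _ J snd) => // [x []//|x]; exact: cvg_snd.
Qed.

(** Compactness of [K], in its near-covering form, turns local closeness into closeness uniform in
    [x]: near each [x], both [Q t y] and [Q s y] are within e / 2 of [Q t x]. Joint continuity is
    assumed only at points of the slice at time [t], because a difference quotient based at [t] is
    controlled only there. *)
Lemma tube (I K : set R) (Q : R -> R -> R) t (e : R) : compact K -> I t -> 0 < e ->
  (forall x, K x ->
    Q p.1 p.2 @[p --> within (I `*` K) (nbhs (t, x))] --> Q t x) ->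
  \forall s \near within I (nbhs t), forall x, K x -> `|Q t x - Q s x| <= e.
Proof.
move=> cK It e0 cQ.
have /near_covering_withinP := (compact_near_coveringP K).1 cK.
move=> /(_ _ (within I (nbhs t)) (fun s x => `|Q t x - Q s x| <= e) _) h.
apply: h => x Kx.
have e20 : 0 < e / 2 by rewrite divr_gt0.
have /cvgrPdist_lt /(_ _ e20) := cQ _ Kx.
rewrite near_withinE => -[[U V]/= [nU nV] UV].
exists (V, U `&` I); first split => //=.
  by rewrite /within/=; move: nU; apply: filterS => s Us Is; split.
move=> [y s]/= [Vy [Us Is]] Ky.
have Ut : U t := nbhs_singleton nU.
have h1 : `|Q t x - Q t y| < e / 2 by apply: (UV (t, y)).
have h2 : `|Q t x - Q s y| < e / 2 by apply: (UV (s, y)).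
rewrite (_ : _ - _ = (Q t x - Q s y) - (Q t x - Q t y)); last by ring.
by rewrite (le_trans (ler_normB _ _))//; lra.
Qed.

Lemma cvg_Rintegral (I : set R) (a b : R) (Q : R -> R -> R) t : a < b -> I t ->
  (forall s, I s -> cont_on `[a, b] (Q s)) ->
  (forall x, a <= x <= b ->
    Q p.1 p.2 @[p --> within (I `*` `[a, b]) (nbhs (t, x))] --> Q t x) ->
  \int[mu]_(x in `[a, b]) Q s x @[s --> within I (nbhs t)] -->
  \int[mu]_(x in `[a, b]) Q t x.
Proof.
move=> ab It cQ Qt; apply/cvgrPdist_le => e e0.
have e1 : 0 < e / (b - a) by rewrite divr_gt0// subr_gt0.
have mI : measurable (`[a, b] : set R) by exact: measurable_itv.
have := @tube I `[a, b] Q t _ (@segment_compact _ a b) It e1.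
move=> /(_ Qt); rewrite !near_withinE; apply: filterS => s h Is.
have cs := cQ _ Is; have ct := cQ _ It.
rewrite -RintegralB//; [|exact: integrable_itvcc..].
have cB : cont_on `[a, b] (fun x => Q t x - Q s x) by prove_cont_on.
apply: le_trans (le_normr_Rintegral _ _) _ => //; first exact: integrable_itvcc.
apply: (@le_trans _ _ (\int[mu]_(x in `[a, b]) (e / (b - a)))).
  apply: le_Rintegral => //.
  - by apply: integrable_itvcc; exact: cont_on_norm.
  - by apply: integrable_itvcc; prove_cont_on.
  - by move=> x xab; exact: h.
rewrite Rintegral_cst//= lebesgue_measure_itv/= lte_fin ab/= divfK//.
by rewrite gt_eqF// subr_gt0.
Qed.

Lemma cont_on_Rintegral (I : set R) (a b : R) (Q : R -> R -> R) : a < b ->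
  cont_on (I `*` `[a, b]) (fun p => Q p.1 p.2) ->
  cont_on I (fun t => \int[mu]_(x in `[a, b]) Q t x).
Proof.
move=> ab cQ; apply/cont_onP => t It; apply: cvg_Rintegral => //.
  by move=> s Is; exact: cont_on_slice Is.
by move=> x xab; move/cont_onP : cQ => /(_ (t, x)); apply; split.
Qed.

(* Writing increments of [F] as integrals of increments of [f] against [g]
   differentiates [\int (f_x)^2] without ever using mixed derivatives. *)
Lemma is_derive_Rintegral (a b : R) (f ft g : R -> R -> R) (F : R -> R) (t : R) :
  a < b -> 0 < t ->
  cont_on ((`](0 : R), +oo[ : set R) `*` `[a, b]) (fun p => f p.1 p.2) ->
  cont_on ((`](0 : R), +oo[ : set R) `*` `[a, b]) (fun p => ft p.1 p.2) ->
  cont_on ((`](0 : R), +oo[ : set R) `*` `[a, b]) (fun p => g p.1 p.2) ->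
  (forall s x : R, 0 < s -> a <= x <= b -> is_derive s 1 (f ^~ x) (ft s x)) ->
  (forall s : R, 0 < s ->
    F s - F t = \int[mu]_(x in `[a, b]) ((f s x - f t x) * g s x)) ->
  is_derive t 1 F (\int[mu]_(x in `[a, b]) (ft t x * g t x)).
Proof.
move=> ab t0 cf cft cg fE FE.
(* The difference quotient is completed by its limit at [s = t]. Differentiating [F] then amounts to
   continuity at [t] of the integral of [q * g]. *)
pose q s x := if s == t then ft t x else (f s x - f t x) / (s - t).
pose I : set R := [set` `](0 : R), +oo[].
have IE (s : R) : I s = (0 < s) :> Prop by rewrite /I/= in_itv/= andbT.
have It : I t by rewrite IE.
have cs (h : R -> R -> R) s : cont_on (I `*` `[a, b]) (fun p => h p.1 p.2) ->
    0 < s -> cont_on `[a, b] (h s).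
  by move=> ch s0; apply: cont_on_slice ch _; rewrite IE.
have cq s : I s -> cont_on `[a, b] (fun x => q s x * g s x).
  rewrite IE => s0; apply: cont_onM; last exact: cs.
  have [->|/negPf st] := eqVneq s t; first by rewrite /q eqxx; exact: cs.
  have c1 := cs f _ cf s0; have c2 := cs f _ cf t0.
  by rewrite /q st; prove_cont_on.
have qcvg x : a <= x <= b ->
    q p.1 p.2 @[p --> within (I `*` `[a, b]) (nbhs (t, x))] --> q t x.
  move=> xab; apply/cvgrPdist_lt => e e0; rewrite /q eqxx.
  move/cont_onP : cft => /(_ (t, x)) /(_ (conj It xab)).
  move=> /cvgrPdist_lt /(_ _ e0); rewrite !near_withinE => -[[U V]/= [nU nV] UV].
  have /nbhs_ballP[r /= r0 rU] := nU.
  exists (ball t r, V); first by split => //=; exact: nbhsx_ballx.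
  move=> [s y]/= [ts Vy] [Is yab].
  have s0 : 0 < s by move: Is; rewrite IE.
  have [st|st] := eqVneq s t.
    by apply: (UV (t, y)) => //; split => //=; exact: rU (ballxx _ _).
  (* By the mean value theorem the quotient is [ft] at an intermediate time, which is at least as
     close to [t] as [s] is. Joint continuity of [ft] thus gives joint convergence of [q]. *)
  suff [c [c0 tc ->]] : exists c, [/\ 0 < c, ball t r c &
      (f s y - f t y) / (s - t) = ft c y].
    have Ic : I c by rewrite IE.
    by apply: (UV (c, y)) => //; split => //=; exact: rU.
  have mvt (u v : R) : u < v -> 0 < u -> exists2 c, u < c < v &
      (f v y - f u y) / (v - u) = ft c y.
    move=> uv u0.
    have d z : u <= z <= v -> is_derive z 1 (f ^~ y) (ft z y).
      by move=> zuv; apply: fE => //; lra.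
    have [||c cuv ->] := @MVT R (f ^~ y) (ft ^~ y) u v uv.
    - by move=> z; rewrite in_itv/= => zuv; apply: d; lra.
    - exact: (@derive_cont_on _ (f ^~ y) (ft ^~ y)).
    by exists c; [rewrite in_itv in cuv|rewrite mulfK// gt_eqF// subr_gt0].
  move: ts; rewrite /ball/= => ts.
  have [st'|st'|] := ltgtP s t; last by move/eqP: st.
  - have [c cst ce] := mvt _ _ st' s0; exists c; split; first lra.
      by rewrite ger0_norm ?subr_ge0; [move: ts; rewrite gtr0_norm; lra|lra].
    by rewrite -ce -[in RHS]opprB -[in RHS](opprB s) mulNr invrN mulrN opprK.
  - have [c cst ce] := mvt _ _ st' t0; exists c; split => //; first lra.
    by rewrite ltr0_norm ?subr_lt0; [move: ts; rewrite ltr0_norm; lra|lra].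
have main := @cvg_Rintegral I a b (fun s x => q s x * g s x) t ab It cq.
apply/is_derive1_diff_quotP.
have {}main : \int[mu]_(x in `[a, b]) (q s x * g s x) @[s --> within I (nbhs t)]
    --> \int[mu]_(x in `[a, b]) (ft t x * g t x).
  have -> : ft t = q t by rewrite /q eqxx.
  apply: main => x xab; apply: cvgM; first exact: qcvg.
  by move/cont_onP : cg => /(_ (t, x)); apply; split.
apply/cvgrPdist_lt => e e0.
move/cvgrPdist_lt : main => /(_ _ e0); rewrite !near_withinE => main.
have pos : \forall s \near t, 0 < s by exact: lt_nbhsr.
near=> s => st.
have s0 : 0 < s by near: s.
have -> : (F s - F t) / (s - t) = \int[mu]_(x in `[a, b]) (q s x * g s x).
  rewrite FE// -RintegralZr//; last first.
    apply: integrable_itvcc.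
    have c1 := cs f _ cf s0; have c2 := cs f _ cf t0; have c3 := cs g _ cg s0.
    by prove_cont_on.
  apply: eq_Rintegral => x _; rewrite /q (negPf st).
  by rewrite mulrAC.
have : I s by rewrite IE.
by near: s.
Unshelve. all: by end_near. Qed.

End parameter_integral.

(** * Integrals over the positive half-line *)

Section integral_Rpos.
Context {R : realType}.
Notation mu := (@lebesgue_measure R).
Notation Rpos := ([set` `](0 : R), +oo[] : set R).

Lemma cont_on_itvcc (f : R -> R) (a b : R) : 0 < a ->
  cont_on Rpos f -> cont_on `[a, b] f.
Proof.
move=> a0; apply: cont_onW => x /=; rewrite !in_itv/= andbT => /andP[ax _].
exact: lt_le_trans ax.
Qed.

Lemma EFin_Rintegral_itvcc (f : R -> R) (a b : R) : cont_on `[a, b] f ->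
  (\int[mu]_(x in `[a, b]) (f x)%:E)%E = (\int[mu]_(x in `[a, b]) f x)%:E.
Proof.
move=> cf; rewrite /Rintegral fineK//; apply: integrable_fin_num => //.
exact: integrable_itvcc.
Qed.

Lemma Rintegral_itvcc_cat (f : R -> R) (a b c : R) : a < b -> b < c ->
  cont_on `[a, c] f ->
  \int[mu]_(x in `[a, c]) f x =
  \int[mu]_(x in `[a, b]) f x + \int[mu]_(x in `[b, c]) f x.
Proof.
move=> ab bc cf; have cbc : cont_on `[b, c] f.
  by apply: cont_onW cf => x /=; rewrite !in_itv/= => /andP[? ->]; rewrite andbT; lra.
have int_ac := integrable_itvcc _ _ _ cf; have int_bc := integrable_itvcc _ _ _ cbc.
have := @Rintegral_itvB _ f (BLeft a) (BRight c) b int_ac.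
rewrite !bnd_simp => /(_ (ltW ab) (ltW bc)).
rewrite Rintegral_itv_obnd_cbnd; first by move=> <-; rewrite addrC subrK.
by apply: integrableS int_bc => //; apply: subset_itvr; rewrite bnd_simp.
Qed.

(** Monotone convergence along compact intervals exhausting the half-line. The lower end [b] may be
    chosen anywhere below [a], and a slack [d] is allowed, because the boundary term at the initial
    time is known to be small only at selected times. Nonnegativity of [f] makes enlarging the
    interval down to [b] harmless. *)
Lemma le_integral_Rpos (f : R -> R) (T M : R) : 0 < T -> cont_on Rpos f ->
  (forall t : R, 0 < t -> 0 <= f t) ->
  (forall a d : R, 0 < a -> a < T -> 0 < d -> exists2 b : R, 0 < b <= a &
     forall X, T < X -> \int[mu]_(t in `[b, X]) f t <= M + d) ->
  (\int[mu]_(t in Rpos) (f t)%:E <= M%:E)%E.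
Proof.
move=> T0 cf f0 hM.
(* The shift to [n.+2] keeps the lower end strictly below [T] already for n = 0, and [n.+1] keeps
   the upper end strictly above it, as [hM] demands. *)
pose F (n : nat) : set R := [set` `[T / n.+2%:R, T + n.+1%:R]].
have Fpos n x : F n x -> 0 < x.
  rewrite /F/= in_itv/= => /andP[h _]; apply: lt_le_trans h.
  by rewrite divr_gt0.
have RposE : \bigcup_n F n = Rpos.
  apply/seteqP; split=> [x [n _ /Fpos x0]|x]; first by rewrite /= in_itv/= x0.
  rewrite /= in_itv/= andbT => x0.
  (* This index dominates both [T / x], for the lower end, and [x], for the upper end. *)
  pose n := Num.bound (T / x + x).
  exists n => //; rewrite /F/= in_itv/=.
  have Tx : 0 < T / x by rewrite divr_gt0.
  have hn : T / x + x < n%:R by apply: archi_boundP; lra.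
  have n2 : n.+2%:R = n%:R + 2 :> R by rewrite -addn2 natrD.
  have n1 : n.+1%:R = n%:R + 1 :> R by rewrite -addn1 natrD.
  apply/andP; split; last by rewrite n1; lra.
  rewrite ler_pdivrMr// n2 -ler_pdivrMl// mulrC; lra.
rewrite -RposE.
have mF i : measurable (F i) by exact: measurable_itv.
have mf i : measurable_fun (F i) (EFin \o f).
  apply/measurable_EFinP; apply: subspace_continuous_measurable_fun => //.
  by apply: (cont_on_itvcc f _ (T + i.+1%:R) _ cf); rewrite divr_gt0.
have cvF : (\int[mu]_(x in F i) (f x)%:E @[i --> \oo] -->
    \int[mu]_(x in \bigcup_i F i) (f x)%:E)%E.
  apply: ge0_nondecreasing_set_cvg_integral => //.
    apply/nondecreasing_seqP => n; rewrite subsetEset /F.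
    apply: subset_itv; rewrite bnd_simp ?lerD2l ?ler_nat//.
    by rewrite ler_pM2l// lef_pV2 ?posrE// ler_nat.
  by move=> i x /Fpos x0; rewrite lee_fin f0.
apply: cvge_le cvF.
apply: nearW => n; apply/lee_addgt0Pr => d d0.
have [|||b /andP[b0 ba] hb] := hM (T / n.+2%:R) d => //.
- by rewrite divr_gt0.
- by rewrite ltr_pdivrMr// ltr_pMr// ltr1n.
have sub : (\int[mu]_(t in F n) (f t)%:E <=
    \int[mu]_(t in `[b, (T + n.+1%:R)%R]) (f t)%:E)%E.
  apply: ge0_subset_integral; [exact: mF|exact: measurable_itv| | |].
  - apply/measurable_EFinP; apply: subspace_continuous_measurable_fun => //.
    exact: cont_on_itvcc.
  - move=> x/=; rewrite in_itv/= => /andP[bx _]; rewrite lee_fin f0//.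
    exact: lt_le_trans bx.
  - by apply: subset_itvr; rewrite bnd_simp.
rewrite (le_trans sub)// EFin_Rintegral_itvcc; last exact: cont_on_itvcc.
by rewrite -EFinD lee_fin hb// ltrDl.
Qed.

End integral_Rpos.

(** * Energy inequalities derived from an abstract differential system *)

Record energy_system {R : realType} (T c L : R) (E D N B : R -> R) : Prop := {
  es_contE : cont_on [set` `](0 : R), +oo[] E;
  es_contD : cont_on [set` `](0 : R), +oo[] D;
  es_contN : cont_on [set` `](0 : R), +oo[] N;
  es_contB : cont_on [set` `](0 : R), +oo[] B;
  es_deriveE : forall t : R, 0 < t -> is_derive t 1 E (- 2 * D t);
  es_deriveD : forall t : R, 0 < t ->
    is_derive t 1 D (- 2 * N t + L / t * B t - 2 / t * D t);
  es_E_ge0 : forall t : R, 0 < t -> 0 <= E t;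
  es_N_ge0 : forall t : R, 0 < t -> 0 <= N t;
  es_hardy : forall t : R, 0 < t ->
    2 * t * D t <= E t / 2 + 2 * t ^+ 2 * N t;
  es_coercive : forall t : R, T <= t -> c * E t <= D t;
  es_bounded : exists K, forall t : R, 0 < t <= 1 -> E t <= K
}.

Section energy_inequalities.
Context {R : realType}.
Notation mu := (@lebesgue_measure R).
Notation Rpos := ([set` `](0 : R), +oo[] : set R).

(** Every clause is linear in the four functions or an inequality stable under sums. This is how the
    systems of the real and imaginary parts combine into one for a complex solution. *)
Lemma energy_systemD (T c L : R) (E1 D1 N1 B1 E2 D2 N2 B2 : R -> R) :
  energy_system T c L E1 D1 N1 B1 -> energy_system T c L E2 D2 N2 B2 ->
  energy_system T c L (fun t => E1 t + E2 t) (fun t => D1 t + D2 t)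
    (fun t => N1 t + N2 t) (fun t => B1 t + B2 t).
Proof.
move=> [c1 c2 c3 c4 dE1 dD1 E10 N10 h1 k1 [K1 b1]].
move=> [c1' c2' c3' c4' dE2 dD2 E20 N20 h2 k2 [K2 b2]].
split; [by prove_cont_on..| | | | | | |].
- move=> t t0; apply: (is_derive_eq (is_derive1D _ _ _ _ _ (dE1 t t0) (dE2 t t0))).
  by ring.
- move=> t t0; apply: (is_derive_eq (is_derive1D _ _ _ _ _ (dD1 t t0) (dD2 t t0))).
  by ring.
- by move=> t t0; rewrite addr_ge0 ?E10 ?E20.
- by move=> t t0; rewrite addr_ge0 ?N10 ?N20.
- by move=> t t0; have := h1 t t0; have := h2 t t0; rewrite !mulrDr !mulrDl; lra.
- by move=> t Tt; rewrite mulrDr lerD ?k1 ?k2.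
- by exists (K1 + K2) => t t1; rewrite lerD ?b1 ?b2.
Qed.

Variables (T c L m : R) (E D N B : R -> R).
Hypotheses (T0 : 0 < T) (c0 : 0 < c) (L0 : 0 < L).
Hypothesis ES : energy_system T c L E D N B.
Hypothesis obs : forall e : R, 0 < e < T ->
  \int[mu]_(t in `[e, T]) (t * B t) <= m.

Let cE := es_contE _ _ _ _ _ _ _ ES.
Let cD := es_contD _ _ _ _ _ _ _ ES.
Let cN := es_contN _ _ _ _ _ _ _ ES.
Let cB := es_contB _ _ _ _ _ _ _ ES.
Let dE := es_deriveE _ _ _ _ _ _ _ ES.
Let dD := es_deriveD _ _ _ _ _ _ _ ES.
Let E0 := es_E_ge0 _ _ _ _ _ _ _ ES.
Let N0 := es_N_ge0 _ _ _ _ _ _ _ ES.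
Let hardy := es_hardy _ _ _ _ _ _ _ ES.
Let coercive := es_coercive _ _ _ _ _ _ _ ES.

(* The mean value theorem on [e, 2e] gives a time where [D] is at most
   [K / (2 e)]. *)
Lemma small_weighted_energy (a d : R) : 0 < a -> 0 < d ->
  exists2 e, 0 < e < a & e ^+ 2 * D e <= d.
Proof.
move=> a0 d0; have [K EK] := es_bounded _ _ _ _ _ _ _ ES.
have K0 : 0 <= K.
  by apply: le_trans (E0 1 ltr01) (EK 1 _); rewrite ltr01 lexx.
(* With 4 r below 1, [a] and [d / (K + 1)], the interval [r, 2r] lies in the range where [E] is
   bounded by [K] and below [a], and 2 r K is at most [d]. Using K + 1 avoids dividing by zero. *)
pose r := Num.min (Num.min 1 a) (d / (K + 1)) / 4.
have dK : 0 < d / (K + 1) by rewrite divr_gt0// ltr_wpDl.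
have r0 : 0 < r by rewrite divr_gt0// !lt_min ltr01 a0 dK.
have r1 : 4 * r <= 1 by rewrite /r mulrC divfK// !ge_min lexx.
have ra : 4 * r <= a by rewrite /r mulrC divfK// !ge_min lexx orbT.
have rd : 4 * r * (K + 1) <= d.
  by rewrite -ler_pdivlMr ?ltr_wpDl// /r mulrC divfK// !ge_min lexx orbT.
have rr : r < 2 * r by lra.
have dEr x : x \in `]r, (2 * r)[ -> is_derive x 1 E (- 2 * D x).
  by rewrite in_itv/= => /andP[rx _]; apply: dE; lra.
have [e er eE] := MVT rr dEr (cont_on_itvcc _ _ (2 * r) r0 cE).
rewrite in_itv/= in er; exists e; first by lra.
have Er : E r <= K by apply: EK; lra.
have E2r : 0 <= E (2 * r) by apply: E0; lra.
have h : 2 * r * D e <= K.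
  have -> : 2 * r * D e = E r - E (2 * r) by rewrite -opprB eE; ring.
  by lra.
(* For positive [D e], the bound e < 2 r gives e^2 D e <= 2 r (2 r D e) <= 2 r K <= d. *)
have [D0|D0] := leP (D e) 0; first by nra.
apply: (@le_trans _ _ (2 * r * (2 * r * D e))).
  rewrite [leRHS](_ : _ = (2 * r) ^+ 2 * D e); last by ring.
  by rewrite ler_pM2r// ler_sqr ?nnegrE; lra.
by apply: le_trans rd; nra.
Qed.

(** Integrate (t^2 D)' = -2 t^2 N + L t B over [e, T] and drop the nonpositive term. The value at
    [e] is kept, to be made small by the choice of [e]. *)
Lemma weighted_energy_le e : 0 < e < T ->
  T ^+ 2 * D T <= e ^+ 2 * D e + L * m.
Proof.
move=> /andP[e_gt0 eT].
pose G (t : R) := t ^+ 2 * D t.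
pose g (t : R) := L * (t * B t) - 2 * t ^+ 2 * N t.
have cid : cont_on Rpos (fun t => t).
  by apply: continuous_subspaceT => ?; exact: cvg_id.
have cG : cont_on Rpos G by rewrite /G; prove_cont_on.
have cg : cont_on Rpos g by rewrite /g; prove_cont_on.
have cLB : cont_on Rpos (fun t => L * (t * B t)) by prove_cont_on.
have cTB : cont_on Rpos (fun t => t * B t) by prove_cont_on.
have dG x : e < x < T -> is_derive x 1 G (g x).
  move=> /andP[ex _]; have x0 : 0 < x by lra.
  have d1 := is_derive1_sqr _ _ _ (is_derive1_id x).
  apply: is_derive_eq; first exact: is_derive1M d1 (dD x x0).
  by rewrite /g; field; rewrite gt_eqF.
have FTC := Rintegral_derive _ _ _ _ eT (cont_on_itvcc _ _ _ e_gt0 cg)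
  (cont_on_itvcc _ _ _ e_gt0 cG) dG.
have : \int[mu]_(x in `[e, T]) g x <= \int[mu]_(x in `[e, T]) (L * (x * B x)).
  apply: le_Rintegral => //.
  - by apply: integrable_itvcc; exact: cont_on_itvcc.
  - by apply: integrable_itvcc; exact: cont_on_itvcc.
  move=> x /=; rewrite in_itv/= => /andP[ex _]; have x0 : 0 < x by lra.
  by rewrite /g gerBl// mulr_ge0 ?N0// mulr_ge0// sqr_ge0.
rewrite FTC RintegralZl//; last by apply: integrable_itvcc; exact: cont_on_itvcc.
have : L * \int[mu]_(x in `[e, T]) (x * B x) <= L * m.
  by rewrite ler_pM2l// obs// e_gt0.
by rewrite /G; lra.
Qed.

(** Coercivity at time [T] bounds c T^2 E(T) by T^2 D(T), and [small_weighted_energy] makes the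
    starting term e^2 D(e) arbitrarily small. *)
Lemma final_energy_le : E T <= L / (T ^+ 2 * c) * m.
Proof.
have T2c : 0 < T ^+ 2 * c by rewrite mulr_gt0// exprn_gt0.
rewrite mulrAC ler_pdivlMr//; apply/ler_addgt0Pr => d d0.
have [e e0 ed] := small_weighted_energy T d T0 d0.
apply: le_trans (_ : _ <= T ^+ 2 * D T) _.
  by rewrite mulrC -mulrA ler_pM2l ?exprn_gt0// coercive.
by have := weighted_energy_le e e0; lra.
Qed.

(* Hardy-type inequality: [(t E - t^2 D)' >= E / 2 - L t B]. *)
Lemma energy_integral_le e : 0 < e < T ->
  \int[mu]_(t in `[e, T]) E t <= 2 * (T * E T + e ^+ 2 * D e + L * m).
Proof.
move=> eT'; have /andP[e_gt0 eT] := eT'.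
pose G (t : R) := t * E t - t ^+ 2 * D t.
pose g (t : R) := E t - 2 * t * D t + 2 * t ^+ 2 * N t - L * (t * B t).
pose h (t : R) := 2^-1 * E t - L * (t * B t).
have cid : cont_on Rpos (fun t => t).
  by apply: continuous_subspaceT => ?; exact: cvg_id.
have cG : cont_on Rpos G by rewrite /G; prove_cont_on.
have cg : cont_on Rpos g by rewrite /g; prove_cont_on.
have ch : cont_on Rpos h by rewrite /h; prove_cont_on.
have c1 : cont_on Rpos (fun t => L * (t * B t)) by prove_cont_on.
have c2 : cont_on Rpos (fun t => 2^-1 * E t) by prove_cont_on.
have cTB : cont_on Rpos (fun t => t * B t) by prove_cont_on.
have dG x : e < x < T -> is_derive x 1 G (g x).
  move=> /andP[ex _]; have x0 : 0 < x by lra.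
  have d1 := is_derive1_sqr _ _ _ (is_derive1_id x).
  apply: is_derive_eq.
    apply: is_derive1B; last exact: is_derive1M d1 (dD x x0).
    exact: is_derive1M (is_derive1_id x) (dE x x0).
  by rewrite /g; field; rewrite gt_eqF.
have FTC := Rintegral_derive _ _ _ _ eT (cont_on_itvcc _ _ _ e_gt0 cg)
  (cont_on_itvcc _ _ _ e_gt0 cG) dG.
have int f : cont_on Rpos f -> mu.-integrable `[e, T] (EFin \o f).
  by move=> cf; apply: integrable_itvcc; exact: cont_on_itvcc.
have : \int[mu]_(x in `[e, T]) h x <= \int[mu]_(x in `[e, T]) g x.
  apply: le_Rintegral => //; [exact: int|exact: int|].
  move=> x /=; rewrite in_itv/= => /andP[ex _]; have x0 : 0 < x by lra.
  by rewrite /g /h; have := hardy x x0; lra.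
rewrite FTC /h RintegralB//; [|exact: int|exact: int].
rewrite !RintegralZl//; [|exact: int|exact: int].
have : L * \int[mu]_(x in `[e, T]) (x * B x) <= L * m.
  by rewrite ler_pM2l// obs.
(* Coercivity at [T] gives the sign of this term, which can then be dropped from [G T]; likewise e
   E(e) is dropped from [G e]. *)
have : 0 <= T ^+ 2 * D T.
  rewrite mulr_ge0 ?sqr_ge0//; apply: le_trans (coercive _ (lexx T)).
  by rewrite mulr_ge0 ?E0// ltW.
have : 0 <= e * E e by rewrite mulr_ge0 ?E0// ltW.
by rewrite /G; lra.
Qed.

(** After [T], coercivity gives E' <= -2 c E. Integrating bounds 2 c times the tail by E(T) - E(X),
    and E(X) is nonnegative. *)
Lemma tail_energy_le X : T < X ->
  \int[mu]_(t in `[T, X]) E t <= E T / (2 * c).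
Proof.
move=> TX.
have cm2D : cont_on Rpos (fun t => - 2 * D t) by prove_cont_on.
have cm2E : cont_on Rpos (fun t => - (2 * c) * E t) by prove_cont_on.
have dE' x : T < x < X -> is_derive x 1 E (- 2 * D x).
  by move=> /andP[Tx _]; apply: dE; exact: lt_trans Tx.
have FTC := Rintegral_derive _ _ _ _ TX (cont_on_itvcc _ _ _ T0 cm2D)
  (cont_on_itvcc _ _ _ T0 cE) dE'.
have int f : cont_on Rpos f -> mu.-integrable `[T, X] (EFin \o f).
  by move=> cf; apply: integrable_itvcc; exact: cont_on_itvcc.
have : \int[mu]_(x in `[T, X]) (- 2 * D x) <=
       \int[mu]_(x in `[T, X]) (- (2 * c) * E x).
  apply: le_Rintegral => //; [exact: int|exact: int|].
  move=> x /=; rewrite in_itv/= => /andP[Tx _].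
  by have := coercive x Tx; lra.
rewrite FTC RintegralZl//; last exact: int.
have : 0 <= E X by apply: E0; exact: lt_trans TX.
rewrite ler_pdivlMr ?mulr_gt0//; lra.
Qed.

(** The integral is cut at [T]. The first piece contributes 2 (T E(T) + L m) and the tail E(T) / (2
    c); inserting [final_energy_le] in both yields the constant. *)
Lemma total_energy_le :
  (\int[mu]_(t in Rpos) (E t)%:E <=
   ((2 * (L / (T * c) + L) + L / (2 * T ^+ 2 * c ^+ 2)) * m)%:E)%E.
Proof.
apply: (le_integral_Rpos E T) => // a d a0 aT d0.
(* Half of the slack, since [energy_integral_le] carries the term e^2 D(e) with a factor 2. *)
have d20 : 0 < d / 2 by rewrite divr_gt0.
have [e e0 ed] := small_weighted_energy a (d / 2) a0 d20.
have eT : 0 < e < T by lra.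
exists e; first by lra.
move=> X TX; have e_gt0 : 0 < e by lra.
rewrite (Rintegral_itvcc_cat E e T X)//; [|lra|exact: cont_on_itvcc].
have h1 := energy_integral_le e eT; have h2 := tail_energy_le X TX.
have h3 := final_energy_le.
have h4 : T * E T <= L / (T * c) * m.
  have -> : L / (T * c) * m = T * (L / (T ^+ 2 * c) * m).
    by field; rewrite !gt_eqF.
  by rewrite ler_pM2l.
have h5 : E T / (2 * c) <= L / (2 * T ^+ 2 * c ^+ 2) * m.
  have -> : L / (2 * T ^+ 2 * c ^+ 2) * m = (L / (T ^+ 2 * c) * m) / (2 * c).
    by field; rewrite !gt_eqF.
  by rewrite ler_pM2r// invr_gt0 mulr_gt0.
by rewrite [leRHS](_ : _ = 2 * (L / (T * c) * m + L * m) +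
  L / (2 * T ^+ 2 * c ^+ 2) * m + d); [lra|ring].
Qed.

End energy_inequalities.

(** * Energy identities for the conjugated heat equation *)

Section conjugated_heat.
Context {R : realType}.
Notation mu := (@lebesgue_measure R).
Notation Rpos := ([set` `](0 : R), +oo[] : set R).

(** Each integration by parts below integrates one exact derivative, expanded into four terms.
    Shorter identities are padded with a zero coefficient. *)
Lemma Rintegral_lincomb (a b : R) (c1 c2 c3 c4 : R) (f1 f2 f3 f4 : R -> R) :
  cont_on `[a, b] f1 -> cont_on `[a, b] f2 ->
  cont_on `[a, b] f3 -> cont_on `[a, b] f4 ->
  \int[mu]_(x in `[a, b]) (c1 * f1 x + c2 * f2 x + c3 * f3 x + c4 * f4 x) =
  c1 * \int[mu]_(x in `[a, b]) f1 x + c2 * \int[mu]_(x in `[a, b]) f2 x +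
  c3 * \int[mu]_(x in `[a, b]) f3 x + c4 * \int[mu]_(x in `[a, b]) f4 x.
Proof.
move=> cf1 cf2 cf3 cf4.
have mI : measurable (`[a, b] : set R) by exact: measurable_itv.
by do 3! (rewrite RintegralD//; [|by apply: integrable_itvcc; prove_cont_on..]);
  rewrite !RintegralZl//; exact: integrable_itvcc.
Qed.

Variables (L : R) (w wt wx wxx : R -> R -> R).
Let Q : set (R * R) := Rpos `*` `[- L, L].
Let k (t : R) := L ^+ 2 / (4 * t ^+ 2).
Hypothesis L0 : 0 < L.
Hypotheses (cw : cont_on Q (fun p => w p.1 p.2))
  (cwt : cont_on Q (fun p => wt p.1 p.2))
  (cwx : cont_on Q (fun p => wx p.1 p.2))
  (cwxx : cont_on Q (fun p => wxx p.1 p.2)).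
Hypothesis dwt : forall t x : R, 0 < t -> - L <= x <= L ->
  is_derive t 1 (w ^~ x) (wt t x).
Hypothesis dwx : forall t x : R, 0 < t -> - L < x < L ->
  is_derive x 1 (w t) (wx t x).
Hypothesis dwxx : forall t x : R, 0 < t -> - L < x < L ->
  is_derive x 1 (wx t) (wxx t x).
Hypothesis weq : forall t x : R, 0 < t -> - L < x < L ->
  wt t x = wxx t x + k t * w t x - x / t * wx t x - w t x / (2 * t).
Hypotheses (wNL : forall t : R, 0 < t -> w t (- L) = 0)
  (wL : forall t : R, 0 < t -> w t L = 0).

Definition energy (t : R) := \int[mu]_(x in `[- L, L]) (w t x ^+ 2).
Definition gradient_energy (t : R) := \int[mu]_(x in `[- L, L]) (wx t x ^+ 2).
Definition dissipation (t : R) := gradient_energy t - k t * energy t.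
Definition residual (t : R) :=
  \int[mu]_(x in `[- L, L]) ((wxx t x + k t * w t x) ^+ 2).
Definition boundary_flux (t : R) := wx t (- L) ^+ 2 + wx t L ^+ 2.

Let LL : - L < L. Proof. by have := L0; lra. Qed.

Lemma Rpos_gt0 (t : R) : 0 < t -> Rpos t.
Proof. by rewrite /= in_itv/= andbT. Qed.

Lemma slice (f : R -> R -> R) (t : R) : cont_on Q (fun p => f p.1 p.2) ->
  0 < t -> cont_on `[- L, L] (f t).
Proof. by move=> cf t0; apply: cont_on_slice cf _; exact: Rpos_gt0. Qed.

Let cid : cont_on `[- L, L] (fun x : R => x).
Proof. by apply: continuous_subspaceT => ?; exact: cvg_id. Qed.

Lemma cont_on_id_Rpos : cont_on Rpos (fun t : R => t).
Proof. by apply: continuous_subspaceT => ?; exact: cvg_id. Qed.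

Lemma cont_on_inv_Rpos : cont_on Rpos (fun t : R => t^-1).
Proof.
apply: cont_onV; last exact: cont_on_id_Rpos.
by move=> x /=; rewrite in_itv/= andbT => x0; rewrite gt_eqF.
Qed.

Let ck : cont_on Rpos k.
Proof.
rewrite /k; have ci := cont_on_inv_Rpos.
suff : cont_on Rpos (fun t => L ^+ 2 / 4 * t^-1 ^+ 2).
  apply: eq_cont_on => t /set_mem/=; rewrite in_itv/= andbT => t0.
  by field; rewrite gt_eqF.
by prove_cont_on.
Qed.

Let int0 (G g : R -> R) (v : R) : cont_on `[- L, L] g -> cont_on `[- L, L] G ->
  (forall x, - L < x < L -> is_derive x 1 G (g x)) -> G L - G (- L) = v ->
  \int[mu]_(x in `[- L, L]) g x = v.
Proof. by move=> cg cG dG <-; exact: Rintegral_derive LL cg cG dG. Qed.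

Lemma cont_on_energy : cont_on Rpos energy.
Proof. by apply: cont_on_Rintegral LL _; prove_cont_on. Qed.

Lemma cont_on_gradient_energy : cont_on Rpos gradient_energy.
Proof. by apply: cont_on_Rintegral LL _; prove_cont_on. Qed.

Lemma cont_on_dissipation : cont_on Rpos dissipation.
Proof.
have c1 := cont_on_energy; have c2 := cont_on_gradient_energy.
by rewrite /dissipation; prove_cont_on.
Qed.

Lemma cont_on_residual : cont_on Rpos residual.
Proof.
apply: cont_on_Rintegral LL _.
have c1 : cont_on Q (fun p => k p.1) by exact: cont_on_fst.
by prove_cont_on.
Qed.

Lemma cont_on_boundary_flux : cont_on Rpos boundary_flux.
Proof.
have c1 : cont_on Rpos (wx ^~ L).
  by apply: cont_on_trace cwx _; rewrite /= in_itv/= lexx andbT ltW.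
have c2 : cont_on Rpos (wx ^~ (- L)).
  by apply: cont_on_trace cwx _; rewrite /= in_itv/= lexx ltW.
by rewrite /boundary_flux; prove_cont_on.
Qed.

(** Factoring w(s)^2 - w(t)^2 puts the increment in the form required by [is_derive_Rintegral]. By
    the equation, 2 w w_t + 2 w_x^2 - 2 k w^2 is the derivative of 2 w w_x - x w^2 / t, which
    vanishes at both ends. *)
Lemma energy_derive (t : R) : 0 < t ->
  is_derive t 1 energy (- 2 * dissipation t).
Proof.
move=> t0; have cwt0 := slice _ _ cw t0; have cwtt := slice _ _ cwt t0.
have cwxt := slice _ _ cwx t0; have cwxxt := slice _ _ cwxx t0.
have main : is_derive t 1 energy
    (\int[mu]_(x in `[- L, L]) (wt t x * (w t x + w t x))).
  have c1 : cont_on Q (fun p => w t p.2) by exact: cont_on_snd.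
  apply: (is_derive_Rintegral (- L) L w wt (fun s x => w s x + w t x)) => //.
    by prove_cont_on.
  move=> s s0; have cws := slice _ _ cw s0.
  rewrite /energy -RintegralB//; [|by apply: integrable_itvcc; prove_cont_on..].
  by apply: eq_Rintegral => x _; ring.
apply: is_derive_eq.
have zero : \int[mu]_(x in `[- L, L]) (1 * (wt t x * (w t x + w t x)) +
    2 * wx t x ^+ 2 + (- 2 * k t) * w t x ^+ 2 + 0 * w t x ^+ 2) = 0.
  apply: (int0 (fun x => 2 * (w t x * wx t x) - t^-1 * (x * w t x ^+ 2))).
  - by prove_cont_on.
  - by prove_cont_on.
  - move=> x xL.
    have d1 := dwx t x t0 xL; have d2 := dwxx t x t0 xL.
    have d3 := is_derive1M _ _ _ _ _ (is_derive1_cst 2 x)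
      (is_derive1M _ _ _ _ _ d1 d2).
    have d4 := is_derive1M _ _ _ _ _ (is_derive1_cst t^-1 x)
      (is_derive1M _ _ _ _ _ (is_derive1_id x) (is_derive1_sqr _ _ _ d1)).
    apply: (is_derive_eq (is_derive1B _ _ _ _ _ d3 d4)).
    by rewrite weq//; field; rewrite gt_eqF.
  - by rewrite wL// wNL//; ring.
rewrite Rintegral_lincomb in zero; [|by prove_cont_on..].
by move: zero; rewrite /dissipation /gradient_energy /energy; lra.
Qed.

(** The integrand w_x(s)^2 - w_x(t)^2 factors, and integration by parts moves the derivative off
    w_x(s) - w_x(t). The boundary terms vanish by the Dirichlet conditions, so only [w] itself is
    differentiated in time. *)
Lemma gradient_energy_derive (t : R) : 0 < t ->
  is_derive t 1 gradient_energy
    (\int[mu]_(x in `[- L, L]) (wt t x * - (wxx t x + wxx t x))).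
Proof.
move=> t0; have cwt0 := slice _ _ cw t0.
have cwxt := slice _ _ cwx t0; have cwxxt := slice _ _ cwxx t0.
have c1 : cont_on Q (fun p => wxx t p.2) by exact: cont_on_snd.
apply: (is_derive_Rintegral (- L) L w wt (fun s x => - (wxx s x + wxx t x))) => //.
  by prove_cont_on.
move=> s s0; have cws := slice _ _ cw s0.
have cwxs := slice _ _ cwx s0; have cwxxs := slice _ _ cwxx s0.
have zero : \int[mu]_(x in `[- L, L]) (1 * wx s x ^+ 2 + (- 1) * wx t x ^+ 2 +
    (- 1) * ((w s x - w t x) * - (wxx s x + wxx t x)) + 0 * w t x) = 0.
  apply: (int0 (fun x => (w s x - w t x) * (wx s x + wx t x))).
  - by prove_cont_on.
  - by prove_cont_on.
  - move=> x xL.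
    have d1 := dwx t x t0 xL; have d2 := dwxx t x t0 xL.
    have d3 := dwx s x s0 xL; have d4 := dwxx s x s0 xL.
    apply: (is_derive_eq (is_derive1M _ _ _ _ _ (is_derive1B _ _ _ _ _ d3 d1)
      (is_derive1D _ _ _ _ _ d4 d2))).
    by ring.
  - by rewrite !wL// !wNL//; ring.
rewrite Rintegral_lincomb in zero; [|by prove_cont_on..].
by move: zero; rewrite /gradient_energy; lra.
Qed.

Lemma dissipation_derive (t : R) : 0 < t -> is_derive t 1 dissipation
  (- 2 * residual t + L / t * boundary_flux t - 2 / t * dissipation t).
Proof.
move=> t0; have cwt0 := slice _ _ cw t0; have cwtt := slice _ _ cwt t0.
have cwxt := slice _ _ cwx t0; have cwxxt := slice _ _ cwxx t0.
have dk : is_derive t 1 k (- (2 / t) * k t).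
  have d1 := is_derive1_sqr _ _ _ (is_derive1_id t).
  have d2 := is_derive1M _ _ _ _ _ (is_derive1_cst 4 t) d1.
  have n0 : 4 * t ^+ 2 != 0 by rewrite mulf_neq0// expf_neq0// gt_eqF.
  have d3 := is_derive1V _ _ _ d2 n0.
  apply: (is_derive_eq (is_derive1M _ _ _ _ _ (is_derive1_cst (L ^+ 2) t) d3)).
  by rewrite /k /GRing.scale/=; field; rewrite gt_eqF.
have dE := energy_derive t t0; have dP := gradient_energy_derive t t0.
apply: (is_derive_eq (is_derive1B _ _ _ _ _ dP (is_derive1M _ _ _ _ _ dk dE))).
(* The multiplier identity behind the observation: the integrand is the derivative of (x w_x^2 + w
   w_x) / t + 2 k w w_x. As [w] vanishes at both ends, only x w_x^2 / t survives there. *)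
have flux : \int[mu]_(x in `[- L, L]) (1 * (wt t x * - (wxx t x + wxx t x)) +
    2 * (wxx t x + k t * w t x) ^+ 2 + (2 / t + 2 * k t) * wx t x ^+ 2 +
    (- 2 * k t ^+ 2) * w t x ^+ 2) = L / t * boundary_flux t.
  apply: (int0 (fun x => t^-1 * (x * wx t x ^+ 2 + w t x * wx t x) +
      2 * k t * (w t x * wx t x))).
  - by prove_cont_on.
  - by prove_cont_on.
  - move=> x xL.
    have d1 := dwx t x t0 xL; have d2 := dwxx t x t0 xL.
    have d12 := is_derive1M _ _ _ _ _ d1 d2.
    have d3 := is_derive1M _ _ _ _ _ (is_derive1_id x) (is_derive1_sqr _ _ _ d2).
    have d4 := is_derive1M _ _ _ _ _ (is_derive1_cst t^-1 x)
      (is_derive1D _ _ _ _ _ d3 d12).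
    have d5 := is_derive1M _ _ _ _ _ (is_derive1_cst (2 * k t) x) d12.
    apply: (is_derive_eq (is_derive1D _ _ _ _ _ d4 d5)).
    by rewrite weq//; field; rewrite gt_eqF.
  - by rewrite wL// wNL// /boundary_flux; ring.
rewrite Rintegral_lincomb in flux; [|by prove_cont_on..].
rewrite -flux /dissipation /residual /gradient_energy /energy.
by field; rewrite gt_eqF.
Qed.

Lemma energy_ge0 (t : R) : 0 <= energy t.
Proof. by apply: Rintegral_ge0 => x _; exact: sqr_ge0. Qed.

Lemma residual_ge0 (t : R) : 0 <= residual t.
Proof. by apply: Rintegral_ge0 => x _; exact: sqr_ge0. Qed.

(** Put r = w_xx + k w. Integration by parts gives D = - \int w r, and the inequality is the
    expansion of 0 <= \int (w + 2 t r)^2 / 2. *)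
Lemma dissipation_hardy (t : R) : 0 < t ->
  2 * t * dissipation t <= energy t / 2 + 2 * t ^+ 2 * residual t.
Proof.
move=> t0; have cwt0 := slice _ _ cw t0.
have cwxt := slice _ _ cwx t0; have cwxxt := slice _ _ cwxx t0.
have zero : \int[mu]_(x in `[- L, L]) (1 * wx t x ^+ 2 +
    1 * (w t x * (wxx t x + k t * w t x)) + (- k t) * w t x ^+ 2 + 0 * w t x) = 0.
  apply: (int0 (fun x => w t x * wx t x)).
  - by prove_cont_on.
  - by prove_cont_on.
  - move=> x xL.
    have d1 := dwx t x t0 xL; have d2 := dwxx t x t0 xL.
    apply: (is_derive_eq (is_derive1M _ _ _ _ _ d1 d2)).
    by ring.
  - by rewrite wL// wNL//; ring.
have : 0 <= \int[mu]_(x in `[- L, L]) (2^-1 * w t x ^+ 2 +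
    2 * t ^+ 2 * (wxx t x + k t * w t x) ^+ 2 +
    2 * t * (w t x * (wxx t x + k t * w t x)) + 0 * w t x).
  apply: Rintegral_ge0 => x _.
  rewrite [leRHS](_ : _ = 2^-1 * (w t x + 2 * t * (wxx t x + k t * w t x)) ^+ 2).
    by rewrite mulr_ge0 ?sqr_ge0// invr_ge0.
  by field.
rewrite Rintegral_lincomb in zero; [|by prove_cont_on..].
rewrite Rintegral_lincomb; [|by prove_cont_on..].
move: zero; rewrite /dissipation /residual /energy /gradient_energy.
set e := \int[mu]_(x in _) (w t x ^+ 2).
set p := \int[mu]_(x in _) (wx t x ^+ 2).
set v := \int[mu]_(x in _) (w t x * _).
move=> /= zero; have -> : p - k t * e = - v by lra.
by lra.
Qed.

(** The inequality [wirtinger] bounds the gradient energy below by a^2 E, and [k] is decreasing in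
    time, so its value at [T] is the worst. *)
Lemma dissipation_coercive (a T t : R) : 0 < a -> a * L < pi / 2 -> 0 < T ->
  T <= t -> (a ^+ 2 - k T) * energy t <= dissipation t.
Proof.
move=> a0 aL T0 Tt; have t0 : 0 < t by exact: lt_le_trans Tt.
have := wirtinger (w t) (wx t) a L L0 a0 aL (slice _ _ cw t0) (slice _ _ cwx t0)
  (fun x => dwx t x t0) (wNL t t0) (wL t t0).
rewrite -/(energy t) -/(gradient_energy t) /dissipation => h.
have kk : k t <= k T.
  rewrite /k ler_pM2l ?exprn_gt0// lef_pV2 ?posrE ?mulr_gt0 ?exprn_gt0//.
  by rewrite ler_pM2l// ler_sqr// nnegrE ltW.
have := ler_wpM2r (energy_ge0 t) kk.
by rewrite mulrBl; lra.
Qed.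

Lemma conjugated_energy_system (a T : R) : 0 < a -> a * L < pi / 2 -> 0 < T ->
  (exists K, forall t : R, 0 < t <= 1 -> energy t <= K) ->
  energy_system T (a ^+ 2 - k T) L energy dissipation residual boundary_flux.
Proof.
move=> a0 aL T0 bdd; split => //.
- exact: cont_on_energy.
- exact: cont_on_dissipation.
- exact: cont_on_residual.
- exact: cont_on_boundary_flux.
- exact: energy_derive.
- exact: dissipation_derive.
- by move=> t _; exact: energy_ge0.
- by move=> t _; exact: residual_ge0.
- exact: dissipation_hardy.
- by move=> t Tt; exact: dissipation_coercive.
Qed.

End conjugated_heat.

(** * Gaussian conjugation of a real solution of the heat equation *)

Section heat_energy.
Context {R : realType}.
Notation mu := (@lebesgue_measure R).
Notation Rpos := ([set` `](0 : R), +oo[] : set R).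

(** Square root of the weight of the observability inequality, so that the energy of the conjugated
    function is the weighted energy of the solution. *)
Definition gaussian (L t x : R) := expR (4^-1 * (x ^+ 2 - L ^+ 2) * t^-1).

Lemma gaussian_le1 (L t x : R) : 0 < t -> - L <= x <= L -> gaussian L t x <= 1.
Proof.
move=> t0 xL; rewrite /gaussian -expR0 ler_expR.
have h : 0 <= (x + L) * (L - x) by rewrite mulr_ge0//; lra.
apply: mulr_le0_ge0; last by rewrite invr_ge0 ltW.
by apply: mulr_ge0_le0; [rewrite invr_ge0|lra].
Qed.

Variables (L : R) (u ut ux uxx : R -> R -> R).
Let Q : set (R * R) := Rpos `*` `[- L, L].
Hypothesis L0 : 0 < L.
Hypotheses (cu : cont_on Q (fun p => u p.1 p.2))
  (cut : cont_on Q (fun p => ut p.1 p.2))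
  (cux : cont_on Q (fun p => ux p.1 p.2))
  (cuxx : cont_on Q (fun p => uxx p.1 p.2)).
Hypothesis dut : forall t x : R, 0 < t -> - L <= x <= L ->
  is_derive t 1 (u ^~ x) (ut t x).
Hypothesis dux : forall t x : R, 0 < t -> - L < x < L ->
  is_derive x 1 (u t) (ux t x).
Hypothesis duxx : forall t x : R, 0 < t -> - L < x < L ->
  is_derive x 1 (ux t) (uxx t x).
Hypothesis heat : forall t x : R, 0 < t -> - L < x < L -> ut t x = uxx t x.
Hypotheses (uNL : forall t : R, 0 < t -> u t (- L) = 0)
  (uL : forall t : R, 0 < t -> u t L = 0).
Hypothesis ubdd : exists K, forall t x : R, 0 < t <= 1 -> - L <= x <= L ->
  `|u t x| <= K.

Let w (t x : R) := u t x * gaussian L t x.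
Let wx (t x : R) := (ux t x + 2^-1 * x * t^-1 * u t x) * gaussian L t x.
Let wxx (t x : R) := (uxx t x + x * t^-1 * ux t x +
  (2^-1 * t^-1 + 4^-1 * x ^+ 2 * t^-1 ^+ 2) * u t x) * gaussian L t x.
Let wt (t x : R) := (ut t x - 4^-1 * (x ^+ 2 - L ^+ 2) * t^-1 ^+ 2 * u t x) *
  gaussian L t x.

Let ci : cont_on Q (fun p => p.1^-1).
Proof. by apply: (cont_on_fst Rpos `[- L, L] (fun t => t^-1)); exact: cont_on_inv_Rpos. Qed.

Let cx : cont_on Q (fun p => p.2).
Proof.
apply: (cont_on_snd Rpos `[- L, L] (fun x => x)).
by apply: continuous_subspaceT => ?; exact: cvg_id.
Qed.

Let cg : cont_on Q (fun p => gaussian L p.1 p.2).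
Proof. by rewrite /gaussian; prove_cont_on. Qed.

Let dgx (t x : R) :
  is_derive x 1 (gaussian L t) (gaussian L t x * (2^-1 * x * t^-1)).
Proof.
have d1 := is_derive1B _ _ _ _ _ (is_derive1_sqr _ _ _ (is_derive1_id x))
  (is_derive1_cst (L ^+ 2) x).
have d2 := is_derive1M _ _ _ _ _ (is_derive1_cst 4^-1 x) d1.
have d3 := is_derive1M _ _ _ _ _ d2 (is_derive1_cst t^-1 x).
apply: (is_derive_eq (is_derive1_expR _ _ _ d3)).
by rewrite -/(gaussian L t x); move: t^-1 => i; field.
Qed.

Let dgt (t x : R) : 0 < t -> is_derive t 1 (fun s => gaussian L s x)
  (gaussian L t x * (- (4^-1 * (x ^+ 2 - L ^+ 2) * t^-1 ^+ 2))).
Proof.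
move=> t0; have d1 := is_derive1V _ _ _ (is_derive1_id t) (lt0r_neq0 t0).
have d2 := is_derive1M _ _ _ _ _ (is_derive1_cst (4^-1 * (x ^+ 2 - L ^+ 2)) t) d1.
apply: (is_derive_eq (is_derive1_expR _ _ _ d2)).
by rewrite -/(gaussian L t x); field; rewrite gt_eqF.
Qed.

Lemma gaussian_boundary (t : R) : gaussian L t (- L) = 1 /\ gaussian L t L = 1.
Proof. by rewrite /gaussian sqrrN subrr mulr0 mul0r expR0. Qed.

(** [D] and [N] are existential because the later bounds see only the weighted energy and the
    observed normal derivatives. *)
Lemma heat_energy_system (a T : R) : 0 < a -> a * L < pi / 2 -> 0 < T ->
  exists D N, energy_system T (a ^+ 2 - L ^+ 2 / (4 * T ^+ 2)) L
    (energy L (fun t x => u t x * gaussian L t x)) D N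
    (fun t => ux t (- L) ^+ 2 + ux t L ^+ 2).
Proof.
move=> a0 aL T0; have [g1 g2] : (forall t, gaussian L t (- L) = 1) /\
    (forall t, gaussian L t L = 1).
  by split=> t; have [] := gaussian_boundary t.
have cw : cont_on Q (fun p => w p.1 p.2) by rewrite /w; prove_cont_on.
have cwt : cont_on Q (fun p => wt p.1 p.2) by rewrite /wt; prove_cont_on.
have cwx : cont_on Q (fun p => wx p.1 p.2) by rewrite /wx; prove_cont_on.
have cwxx : cont_on Q (fun p => wxx p.1 p.2) by rewrite /wxx; prove_cont_on.
have LL : - L < L by have := L0; lra.
have ES : energy_system T (a ^+ 2 - L ^+ 2 / (4 * T ^+ 2)) L
    (energy L w) (dissipation L w wx) (residual L w wxx) (boundary_flux L wx).
  apply: (conjugated_energy_system L w wt wx wxx) => //.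
  - move=> t x t0 xL.
    apply: (is_derive_eq (is_derive1M _ _ _ _ _ (dut t x t0 xL) (dgt t x t0))).
    by rewrite /wt; ring.
  - move=> t x t0 xL.
    apply: (is_derive_eq (is_derive1M _ _ _ _ _ (dux t x t0 xL) (dgx t x))).
    by rewrite /wx; ring.
  - move=> t x t0 xL.
    have d1 := is_derive1M _ _ _ _ _ (is_derive1_cst 2^-1 x) (is_derive1_id x).
    have d2 := is_derive1M _ _ _ _ _ d1 (is_derive1_cst t^-1 x).
    have d3 := is_derive1M _ _ _ _ _ d2 (dux t x t0 xL).
    have d4 := is_derive1D _ _ _ _ _ (duxx t x t0 xL) d3.
    apply: (is_derive_eq (is_derive1M _ _ _ _ _ d4 (dgx t x))).
    by rewrite /wxx; field; rewrite gt_eqF.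
  - move=> t x t0 xL; rewrite /wt /wxx /wx /w heat//.
    by field; rewrite gt_eqF.
  - by move=> t t0; rewrite /w uNL// mul0r.
  - by move=> t t0; rewrite /w uL// mul0r.
  (* Near the initial time the energy stays bounded because the weight is at most 1 and [u] is
     bounded there. *)
  have [K uK] := ubdd.
  exists (\int[mu]_(x in `[- L, L]) (K ^+ 2)) => t t1.
  have t0 : 0 < t by case/andP: t1.
  have cwt0 : cont_on `[- L, L] (w t).
    by apply: cont_on_slice cw _; rewrite /= in_itv/= t0.
  apply: le_Rintegral => //.
  - by apply: integrable_itvcc; prove_cont_on.
  - by apply: integrable_itvcc; prove_cont_on.
  move=> x/=; rewrite in_itv/= => xL; rewrite -real_normK ?num_real//.
  have g0 : 0 < gaussian L t x by exact: expR_gt0.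
  have h : `|w t x| <= K.
    rewrite /w normrM (gtr0_norm g0) (le_trans _ (uK t x t1 xL))//.
    by rewrite ler_piMr// gaussian_le1.
  by rewrite ler_sqr// nnegrE//; exact: le_trans h.
exists (dissipation L w wx), (residual L w wxx).
(* At both endpoints the Gaussian equals 1 and [u] vanishes, so [wx] agrees with [ux]. *)
have BE t : 0 < t -> boundary_flux L wx t = ux t (- L) ^+ 2 + ux t L ^+ 2.
  move=> t0; rewrite /boundary_flux /wx uL// uNL// g1 g2; ring.
case: ES => ? ? ? cB ? dD ? ? ? ? ?; split => //.
- apply: eq_cont_on cB => t /set_mem/=; rewrite in_itv/= andbT.
  exact: BE.
- by move=> t t0; rewrite -BE//; exact: dD.
Qed.

End heat_energy.

(** * The energy system of one real component of a smooth solution *)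

Section solution_components.
Context {R : realType}.
Notation mu := (@lebesgue_measure R).

Lemma derivable_in_is_derive (A : set R) (f : R -> R) (x : R) : nbhs x A ->
  derivable_in A f x -> is_derive x 1 f (derive_in A f x).
Proof.
move=> Ax df; apply/is_derive1_diff_quotP/cvgrPdist_lt => e e0.
have := df; rewrite /derivable_in => /cvgrPdist_lt /(_ e e0).
rewrite !near_withinE => h; near=> y => yx.
have Ay : A y by near: y.
by apply: (near h y).
Unshelve. all: by end_near. Qed.

Lemma component_energy_system (L T a : R) (u : R -> R -> R) :
  0 < L -> 0 < T -> 0 < a -> a * L < pi / 2 ->
  class_C 2 `]0, +oo[ `[- L, L] u ->
  {within `[0, +oo[ `*` `[- L, L], continuous (fun p : R * R => u p.1 p.2)} ->
  (forall t x : R, 0 < t -> - L < x < L -> partial_t `]0, +oo[ u t x =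
    partial_x `[- L, L] (partial_x `[- L, L] u) t x) ->
  (forall t : R, 0 < t -> u t (- L) = 0) ->
  (forall t : R, 0 < t -> u t L = 0) ->
  exists D N, energy_system T (a ^+ 2 - L ^+ 2 / (4 * T ^+ 2)) L
    (energy L (fun t x => u t x * gaussian L t x)) D N
    (fun t => partial_x `[- L, L] u t (- L) ^+ 2 + partial_x `[- L, L] u t L ^+ 2).
Proof.
move=> L0 T0 a0 aL [cu [dut dux [cut _] [cux [_ dux2 _ [cuxx _]]]]] c0 heat uNL uL.
have It (t : R) : 0 < t -> nbhs t ([set` `]0, +oo[] : set R).
  by move=> t0; apply: open_nbhs_nbhs; split; [exact: interval_open|rewrite /= in_itv/= t0].
have Jx (x : R) : - L < x < L -> nbhs x ([set` `[- L, L]] : set R).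
  move=> xL; have : nbhs x ([set` `](- L), L[] : set R).
    by apply: open_nbhs_nbhs; split; [exact: interval_open|rewrite /= in_itv/=].
  by apply: filterS => y /=; rewrite !in_itv/= => /andP[? ?]; rewrite !ltW.
have Ip (t : R) : 0 < t -> ([set` `]0, +oo[] : set R) t.
  by move=> t0; exact: nbhs_singleton (It t t0).
have Jp (x : R) : - L < x < L -> ([set` `[- L, L]] : set R) x.
  by move=> xL; exact: nbhs_singleton (Jx x xL).
apply (heat_energy_system L u (partial_t `]0, +oo[ u) (partial_x `[- L, L] u)
  (partial_x `[- L, L] (partial_x `[- L, L] u))) => //.
- move=> t x t0 xL; apply: derivable_in_is_derive; first exact: It.
  by apply: dut; [exact: Ip|rewrite /= in_itv].
- move=> t x t0 xL; apply: derivable_in_is_derive; first exact: Jx.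
  by apply: dux; [exact: Ip|exact: Jp].
- move=> t x t0 xL; apply: derivable_in_is_derive; first exact: Jx.
  by apply: dux2; [exact: Ip|exact: Jp].
(* Continuity up to t = 0 bounds [u] on the compact rectangle [0, 1] x [-L, L]; this provides the
   energy bound near the initial time. *)
have cK : compact (([set` `[0, 1]] : set R) `*` ([set` `[- L, L]] : set R)).
  by apply: compact_setX; exact: segment_compact.
have c1 : cont_on (([set` `[0, 1]] : set R) `*` ([set` `[- L, L]] : set R))
    (fun p => u p.1 p.2).
  by apply: cont_onW c0 => -[t x] [/= + Jx']; rewrite !in_itv/= => /andP[-> _].
have /compact_bounded[M [_ MP]] := continuous_compact c1 cK.
exists (M + 1) => t x /andP[t0 t1] xL.
apply: (MP (M + 1)); first by rewrite ltrDl.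
by exists (t, x) => //; split; rewrite /= in_itv/= ?(ltW t0) ?t1.
Qed.

End solution_components.

(** * Passage between extended and real integrals *)

Section ereal_integrals.
Context {R : realType}.
Notation mu := (@lebesgue_measure R).

Lemma measurable_cont_on (A : set R) (f : R -> R) : measurable A -> cont_on A f ->
  measurable_fun A (EFin \o f).
Proof.
by move=> mA cf; apply/measurable_EFinP; exact: subspace_continuous_measurable_fun.
Qed.

Lemma integral_itvoo_Rintegral (a b : R) (f : R -> R) : cont_on `[a, b] f ->
  (\int[mu]_(x in `]a, b[) (f x)%:E)%E = (\int[mu]_(x in `[a, b]) f x)%:E.
Proof.
move=> cf; rewrite -EFin_Rintegral_itvcc//.
have mf (i : interval R) : [set` i] `<=` [set` `[a, b]] ->
    measurable_fun [set` i] (EFin \o f).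
  by move=> si; apply: measurable_cont_on => //; exact: cont_onW cf.
rewrite integral_itv_bndo_bndc; last first.
  by apply: mf => x /=; rewrite !in_itv/= => /andP[? ?]; rewrite !ltW.
rewrite integral_itv_obnd_cbnd//.
by apply: mf => x /=; rewrite !in_itv/= => /andP[? ->]; rewrite ltW.
Qed.

(** Supplies the hypothesis [obs] of the energy inequalities from a finite integral starting at 0,
    by monotonicity in the domain. *)
Lemma le_Rintegral_itvoo (a T m : R) (f : R -> R) : 0 < a -> a < T ->
  cont_on [set` `](0 : R), +oo[] f -> (forall t : R, 0 < t -> 0 <= f t) ->
  (\int[mu]_(x in `]0%R, T[) (f x)%:E)%E = m%:E ->
  \int[mu]_(x in `[a, T]) f x <= m.
Proof.
move=> a0 aT cf f0 fm; have caT := cont_on_itvcc _ _ T a0 cf.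
rewrite -lee_fin -integral_itvoo_Rintegral// -fm.
apply: ge0_subset_integral => //.
- apply: measurable_cont_on => //; apply: cont_onW cf => x /=.
  by rewrite !in_itv/= andbT => /andP[].
- by move=> x /=; rewrite in_itv/= => /andP[x0 _]; rewrite lee_fin f0.
- by apply: subset_itvr; rewrite bnd_simp ltW.
Qed.

End ereal_integrals.

(** * The observability inequality for complex solutions *)

Lemma normsqE {R : realType} (z : R[i]) :
  normsq z = complex.Re z ^+ 2 + complex.Im z ^+ 2.
Proof.
by case: z => a b; rewrite /normsq /= sqr_sqrtr// addr_ge0// sqr_ge0.
Qed.

Theorem theorem1p3 (R : realType) (L : R) (hL : 0 < L)
    (T : R) (hT : 0 < T) (hTL : L ^+ 2 < pi * T) :
  exists C : R, 0 < C /\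
    forall (z0 : R -> R[i]) (z : R -> R -> R[i]),
      smooth_heat_solution L z0 z ->
      (\int[lebesgue_measure]_(x in `](- L)%R, L[)
           (normsq (z T x) * expR ((x ^+ 2 - L ^+ 2) / (2 * T)))%:E
       + \int[lebesgue_measure]_(t in `]0%R, +oo[)
           \int[lebesgue_measure]_(x in `](- L)%R, L[)
             (normsq (z t x) * expR ((x ^+ 2 - L ^+ 2) / (2 * t)))%:E
       <= C%:E * \int[lebesgue_measure]_(t in `]0%R, T[)
             (t * (normsq (dx L z t (- L)) + normsq (dx L z t L)))%:E)%E.
Proof.
(* The midpoint of L / (2 T) and pi / (2 L), which are in this order exactly when L^2 < pi T. Being
   above the first makes [c] positive; being below the second is what [wirtinger] requires. *)
pose a : R := (L / (2 * T) + pi / (2 * L)) / 2.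
have LT0 : 0 < L / (2 * T) by rewrite divr_gt0// mulr_gt0.
have LTpi : L / (2 * T) < pi / (2 * L).
  rewrite ltr_pdivrMr ?mulr_gt0// mulrAC ltr_pdivlMr ?mulr_gt0//.
  by move: hTL; rewrite expr2; lra.
have a0 : 0 < a by rewrite /a; lra.
have La : L / (2 * T) < a by rewrite /a; lra.
have aL : a * L < pi / 2.
  have -> : pi / 2 = pi / (2 * L) * L by field; rewrite gt_eqF.
  by rewrite ltr_pM2r// /a; lra.
pose c := a ^+ 2 - L ^+ 2 / (4 * T ^+ 2).
have c0 : 0 < c.
  rewrite subr_gt0 [ltLHS](_ : _ = (L / (2 * T)) ^+ 2); last by field; rewrite gt_eqF.
  by rewrite ltr_sqr// nnegrE ltW.
(* [C1] comes from [final_energy_le] and [C2] from [total_energy_le]. *)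
pose C1 := L / (T ^+ 2 * c).
pose C2 := 2 * (L / (T * c) + L) + L / (2 * T ^+ 2 * c ^+ 2).
have C10 : 0 < C1 by rewrite divr_gt0// mulr_gt0// exprn_gt0.
have C20 : 0 < C2.
  by rewrite addr_gt0 ?divr_gt0// mulr_gt0 ?addr_gt0 ?divr_gt0// ?mulr_gt0// ?exprn_gt0.
exists (C1 + C2); split; first exact: addr_gt0.
move=> z0 z [smooth [cRe0 cIm0] heat bdry _].
have [sRe sIm] := smooth 2%N.
have [D1 [N1 ES1]] := component_energy_system L T a (re_part z) hL hT a0 aL sRe cRe0
  (fun t x t0 xL => subr0_eq (congr1 (@complex.Re R) (heat t x t0 xL)))
  (fun t t0 => congr1 (@complex.Re R) (bdry t t0).1)
  (fun t t0 => congr1 (@complex.Re R) (bdry t t0).2).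
have [D2 [N2 ES2]] := component_energy_system L T a (im_part z) hL hT a0 aL sIm cIm0
  (fun t x t0 xL => subr0_eq (congr1 (@complex.Im R) (heat t x t0 xL)))
  (fun t t0 => congr1 (@complex.Im R) (bdry t t0).1)
  (fun t t0 => congr1 (@complex.Im R) (bdry t t0).2).
have ES := energy_systemD _ _ _ _ _ _ _ _ _ _ _ ES1 ES2.
move: ES; set E := fun t => _ + _; set B := fun t => (_ ^+ 2 + _) + _ => ES.
have EE (t : R) : 0 < t ->
    (\int[lebesgue_measure]_(x in `](- L)%R, L[)
      (normsq (z t x) * expR ((x ^+ 2 - L ^+ 2) / (2 * t)))%:E = (E t)%:E)%E.
  move=> t0.
  have It : [set` `](0 : R), +oo[] t by rewrite /= in_itv/= t0.
  have cz := cont_on_slice _ _ _ t sRe.1 It.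
  have cz' := cont_on_slice _ _ _ t sIm.1 It.
  have cg : cont_on `[- L, L] (gaussian L t).
    have cid : cont_on `[- L, L] (fun x => x).
      by apply: continuous_subspaceT => ?; exact: cvg_id.
    by rewrite /gaussian; prove_cont_on.
  have ce (f : R -> R) : cont_on `[- L, L] f ->
      cont_on `[- L, L] (fun x => (f x * gaussian L t x) ^+ 2).
    by move=> cf; prove_cont_on.
  rewrite /E /energy -RintegralD//; [|by apply: integrable_itvcc; exact: ce..].
  rewrite -integral_itvoo_Rintegral; last by apply: cont_onD; exact: ce.
  apply: eq_integral => x _; congr EFin.
  rewrite normsqE !exprMn -mulrDl; congr (_ * _).
  (* Squaring the Gaussian doubles its exponent, which recovers the weight of the statement. *)
  by rewrite /gaussian -expRM_natl; congr expR; field; rewrite gt_eqF.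
rewrite EE//.
have -> : (\int[lebesgue_measure]_(t in `]0%R, +oo[)
    \int[lebesgue_measure]_(x in `](- L)%R, L[)
      (normsq (z t x) * expR ((x ^+ 2 - L ^+ 2) / (2 * t)))%:E =
    \int[lebesgue_measure]_(t in `]0%R, +oo[) (E t)%:E)%E.
  by apply: eq_integral => t /set_mem /=; rewrite in_itv/= andbT; exact: EE.
have -> : (\int[lebesgue_measure]_(t in `]0%R, T[)
    (t * (normsq (dx L z t (- L)) + normsq (dx L z t L)))%:E =
    \int[lebesgue_measure]_(t in `]0%R, T[) (t * B t)%:E)%E.
  apply: eq_integral => t _; congr (_ * _)%:E.
  by rewrite !normsqE /B addrACA.
have B0 t : 0 <= B t by rewrite !addr_ge0// sqr_ge0.
have I0 : (0 <= \int[lebesgue_measure]_(t in `]0%R, T[) (t * B t)%:E)%E.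
  apply: integral_ge0 => t /=; rewrite in_itv/= => /andP[t0 _].
  by rewrite lee_fin mulr_ge0// ltW.
(* The observation may be infinite, in which case the right-hand side is infinite too; the value -oo
   is excluded by [I0]. *)
case Im : (\int[lebesgue_measure]_(t in `]0%R, T[) (t * B t)%:E)%E I0 => [m| |]//.
  move=> _.
  have cB := es_contB _ _ _ _ _ _ _ ES.
  have cid := @cont_on_id_Rpos R.
  have obs e : 0 < e < T -> \int[lebesgue_measure]_(t in `[e, T]) (t * B t) <= m.
    move=> /andP[e0 eT]; apply: (le_Rintegral_itvoo e T) => //.
    - by prove_cont_on.
    - by move=> t t0; rewrite mulr_ge0// ltW.
  have h1 := final_energy_le T c L m E _ _ B hT c0 hL ES obs.
  have h2 := total_energy_le T c L m E _ _ B hT c0 hL ES obs.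
  have -> : ((C1 + C2)%:E * m%:E = (C1 * m)%:E + (C2 * m)%:E)%E.
    by rewrite -EFinM mulrDl.
  by apply: leeD; [rewrite lee_fin; exact: h1|exact: h2].
by move=> _; rewrite gt0_muley ?leey// lte_fin addr_gt0.
Qed.
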